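(* Let $G=(V,E)$ be a graph which does not admit detours. Then there exist a sequence of pairs $(x_n,y_n)\in V^2$ with $d(x_n,y_n)\to\infty$ as $n\to\infty$ and a pair of atomless probability measures $\nu,\tilde\nu$ on $[0,\infty)$ with finite mean which are supported away from $0$ and such that $\tilde\nu$ is strictly more variable than $\nu$, but $$\mathbb{E}T(x_n,y_n)=\mathbb{E}\tilde T(x_n,y_n)$$ for all $n$. In particular, if $G$ has bounded degree, then $G$ does not satisfy the vdBK property.
   Context: **Graphs.** A graph $G=(V,E)$ is a pair of sets with a boundary map from $E$ to the two-element subsets of $V$ (parallel edges allowed, no self-loops). The ambient graph is always assumed connected, locally finite, and with $V$ countably infinite. A path is an alternating sequence of vertices and edges, starting and ending with a vertex, in which the two vertices next to an edge form its boundary; we identify a path with its set of edges, and $|\pi|$ is the number of edges appearing in $\pi$. A path is self-avoiding if it has no repeated vertices. $d$ is the graph distance and $B(x,R)=\{y\in V: d(x,y)\le R\}$. An edge-geodesic is a path of minimal length between its endpoints. **Detours.** For two paths $\pi,\pi'$ with the same starting point and the same ending point and $\pi\neq\pi'$ as edge sets, $\pi'$ is an $\epsilon$-detour for $\pi$ if $|\pi'\setminus\pi|\le(1+\epsilon)|\pi\setminus\pi'|$ (set differences of edge sets). $G$ admits detours if for every $\epsilon>0$ there is some (positive integer) $C$ such that every self-avoiding path $\pi$ in $G$ of length $C$ has a self-avoiding $\epsilon$-detour. **First passage percolation.** Given a probability measure $\nu$ on $[0,\infty)$, let $(w(e))_{e\in E}$ be i.i.d. with law $\nu$, $T(\pi)=\sum_{e\in\pi}w(e)$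 for a path $\pi$ without repeated edges, and $T(x,y)=\inf\{T(\gamma):\gamma \text{ a self-avoiding path from } x \text{ to } y\}$. $\tilde T$ is defined in the same way from $\tilde\nu$. **More variable.** $\tilde\nu$ is more variable than $\nu$ if $\int f\,d\tilde\nu\le\int f\,d\nu$ for every concave nondecreasing $f:\mathbb{R}\to\mathbb{R}$ for which both integrals converge absolutely; strictly more variable if moreover $\tilde\nu\ne\nu$. **Exponential subcriticality.** For $p\in[0,1]$, $G_p$ is the random subgraph keeping each edge independently with probability $p$. Let $\underline{p_c}$ be the supremum of $p\in[0,1]$ with $\limsup_{R\to\infty}\sup_{o\in V}\frac1R\log\mathbb{P}(G_p\text{ contains a path from }o\text{ to }B(o,R)^c)<0$, and let $\vec{\underline{p_c}}$ be the supremum of $p\in[0,1]$ with $\limsup_{R\to\infty}\sup_{o\in V}\frac1R\log\mathbb{P}(G_p\text{ contains a path from }o\text{ to }B(o,R)^c\text{ which is edge-geodesic in }G)<0$. $\nu$ is exponential-subcritical if either $\inf\operatorname{supp}\nu=0$ and $\nu(\{0\})<\underline{p_c}$, or $a:=\inf\operatorname{supp}\nu>0$ and $\nu(\{a\})<\vec{\underline{p_c}}$. **vdBK property.** $G$ has the vdBK property if for all probability measures $\nu,\tilde\nu$ on $[0,\infty)$ with finite mean such that $\nu$ is exponential-subcritical and $\tilde\nu$ is strictly more variable than $\nu$, $$\liminf_{d(x,y)\to\infty}\frac{\mathbb{E}T(x,y)-\mathbb{E}\tilde T(x,y)}{d(x,y)}>0 .$$ *)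

(* Defs.v *)
From mathcomp Require Import all_boot all_order all_algebra finmap.
From mathcomp Require Import all_classical all_reals all_analysis.
Import Order.TTheory GRing.Theory Num.Theory.
Import numFieldNormedType.Exports.

Set Implicit Arguments.
Unset Strict Implicit.
Unset Printing Implicit Defensive.

Local Open Scope classical_set_scope.
Local Open Scope ring_scope.

(** * Multigraphs *)

Record multigraph (V E : choiceType) := Multigraph {
  boundary : E -> {fset V};
  card_boundary : forall e, #|` boundary e|%fset = 2%N
}.

Section Graphs.
Variables (V E : choiceType) (G : multigraph V E).

Definition incident (v : V) : set E := [set e | v \in boundary G e].

(* The alternating sequence x, e1, v1, ..., en, vn is the starting vertex x
   together with the list p = [:: (e1, v1); ...; (en, vn)]. *)
Fixpoint is_path (x : V) (p : seq (E * V)) : bool :=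
  if p is (e, y) :: p' then (boundary G e == [fset x; y]%fset) && is_path y p'
  else true.

Definition endpoint (x : V) (p : seq (E * V)) : V := last x (unzip2 p).

Definition path_between (x y : V) (p : seq (E * V)) : bool :=
  is_path x p && (endpoint x p == y).

Definition edges (p : seq (E * V)) : {fset E} := [fset e in unzip1 p]%fset.

Definition path_length (p : seq (E * V)) : nat := #|` edges p|%fset.

Definition self_avoiding (x : V) (p : seq (E * V)) : bool :=
  is_path x p && uniq (x :: unzip2 p).

Definition self_avoiding_between (x y : V) (p : seq (E * V)) : bool :=
  self_avoiding x p && (endpoint x p == y).

Definition connected_graph : Prop := forall x y, exists p, path_between x y p.

Definition locally_finite : Prop := forall v, finite_set (incident v).

Definition degree (v : V) : nat := #|` fset_set (incident v)|%fset.

Definition bounded_degree : Prop :=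
  locally_finite /\ exists D : nat, forall v, (degree v <= D)%N.

Definition ambient_graph : Prop :=
  [/\ connected_graph, locally_finite, countable [set: V]
    & infinite_set [set: V]].

(* The least length of a path from x to y; 0 by convention if there is none. *)
Definition dist (x y : V) : nat :=
  if pselect (exists n, `[< exists2 p, path_between x y p & path_length p = n >])
    is left ex then ex_minn ex else 0%N.

Definition graph_ball (x : V) (r : nat) : set V := [set y | (dist x y <= r)%N].

Definition edge_geodesic (x : V) (p : seq (E * V)) : Prop :=
  is_path x p /\
  forall q, path_between x (endpoint x p) q -> (path_length p <= path_length q)%N.

Definition detour (R : realType) (eps : R) (x : V) (p p' : seq (E * V)) : Prop :=
  [/\ path_between x (endpoint x p) p', edges p != edges p'
    & (#|` edges p' `\` edges p|%fset)%:R
        <= (1 + eps) * (#|` edges p `\` edges p'|%fset)%:R].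

Definition admits_detours (R : realType) : Prop :=
  forall eps : R, 0 < eps -> exists2 C : nat, (0 < C)%N &
    forall x p, self_avoiding x p -> path_length p = C ->
      exists2 p', self_avoiding x p' & detour eps x p p'.

Definition path_time (R : realType) (w : E -> R) (p : seq (E * V)) : R :=
  \sum_(e <- edges p) w e.

Definition passage_time (R : realType) (w : E -> R) (x y : V) : R :=
  inf [set path_time w p | p in [set p | self_avoiding_between x y p]].

End Graphs.

(** * Independent identically distributed families *)

Section IID.
Context d d' (Omega : measurableType d) (T : measurableType d') (R : realType).
Variables (P : probability Omega R) (I : choiceType) (X : I -> {RV P >-> T}).

Definition mutually_independent : Prop :=
  forall (J : {fset I}) (A : I -> set T), (forall i, measurable (A i)) ->
    P (\bigcap_(i in [set` J]) X i @^-1` A i)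
      = (\prod_(i <- J) P (X i @^-1` A i))%E.

Definition iid (nu : probability T R) : Prop :=
  mutually_independent /\
  forall i A, measurable A -> distribution P (X i) A = nu A.

End IID.

(** * Laws on the half-line *)

Section Laws.
Variable R : realType.
Local Notation law := (probability (measurableTypeR R) R).
Implicit Types nu : law.

Definition on_nonneg nu : Prop := nu `[0, +oo[%classic = 1%E.

Definition finite_mean nu : Prop := nu.-integrable [set: R] (fun x => x%:E).

Definition atomless nu : Prop :=
  forall A : set R, measurable A -> (0 < nu A)%E ->
    exists2 B : set R, measurable B /\ B `<=` A & (0 < nu B < nu A)%E.

Definition law_support nu : set R :=
  [set x | forall U : set R, open U -> U x -> (0 < nu U)%E].

Definition supported_away_from0 nu : Prop :=
  exists2 delta : R, 0 < delta & law_support nu `<=` `[delta, +oo[.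

Definition concave (f : R -> R) : Prop :=
  convex_function [set: R^o] (fun x => - f x).

Definition more_variable (nut nu : law) : Prop :=
  forall f : R -> R, concave f -> nondecreasing f ->
    nut.-integrable [set: R] (EFin \o f) -> nu.-integrable [set: R] (EFin \o f) ->
    (\int[nut]_x (f x)%:E <= \int[nu]_x (f x)%:E)%E.

(* Measures are functions on all subsets of R, so that only their values on
   Borel sets are significant. *)
Definition strictly_more_variable (nut nu : law) : Prop :=
  more_variable nut nu /\ exists2 A : set R, measurable A & nut A <> nu A.

End Laws.

(** * Percolation *)

Section Percolation.
Variables (R : realType) (V E : choiceType) (G : multigraph V E).

Definition escapes (Q : V -> seq (E * V) -> Prop) (open_edge : E -> bool)
    (o : V) (r : nat) : Prop :=
  exists p, [/\ is_path G o p, (forall e, e \in edges p -> open_edge e),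
                ~ graph_ball G o r (endpoint o p) & Q o p].

(* Only the law of the family X matters, so every realization is considered;
   lne 0 = -oo, so that a vanishing escape probability counts as decaying. *)
Definition exponential_decay (Q : V -> seq (E * V) -> Prop) (p : R) : Prop :=
  forall (d : measure_display) (Omega : measurableType d)
    (P : probability Omega R) (X : E -> {RV P >-> bool}),
  iid X (bernoulli_prob p) ->
  (limn_esup (fun r : nat => ereal_sup (range (fun o : V =>
     (r%:R^-1)%:E * lne (P [set om | escapes Q (fun e => X e om) o r])))) < 0)%E.

Definition critical_sup (Q : V -> seq (E * V) -> Prop) : R :=
  sup [set p : R | 0 <= p <= 1 /\ exponential_decay Q p].

Definition pc_low : R := critical_sup (fun _ _ => True).

Definition pc_geo_low : R := critical_sup (edge_geodesic G).

Definition exp_subcritical (nu : probability (measurableTypeR R) R) : Prop :=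
  let a := inf (law_support nu) in
  (a = 0 /\ (nu [set 0%R] < pc_low%:E)%E) \/
  (0 < a /\ (nu [set a] < pc_geo_low%:E)%E).

End Percolation.

(** * First passage percolation *)

Section FPP.
Variables (R : realType) (V E : choiceType) (G : multigraph V E).

(* Edge weights take values in the half-line at every point of Omega, so that the
   infimum defining the passage time is bounded below. *)
Definition iid_weights d (Omega : measurableType d) (P : probability Omega R)
    (nu : probability (measurableTypeR R) R)
    (w : E -> {RV P >-> measurableTypeR R}) : Prop :=
  iid w nu /\ forall e om, 0 <= w e om.

Definition mean_passage_time d (Omega : measurableType d)
    (P : probability Omega R) (w : E -> {RV P >-> measurableTypeR R})
    (x y : V) : \bar R :=
  'E_P[fun om => passage_time G (fun e => w e om) x y]%E.

(* liminf of f (x, y) as the graph distance of x and y tends to infinity *)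
Definition liminf_dist (f : V -> V -> \bar R) : \bar R :=
  ereal_sup (range (fun n : nat =>
    ereal_inf [set f z.1 z.2 | z in [set z : V * V | (n <= dist G z.1 z.2)%N]])).

(* The expected passage times depend only on the laws nu and nut, so all
   realizations of the edge weights are considered. *)
Definition vdBK_property : Prop :=
  forall nu nut : probability (measurableTypeR R) R,
  on_nonneg nu -> on_nonneg nut -> finite_mean nu -> finite_mean nut ->
  exp_subcritical G nu -> strictly_more_variable nut nu ->
  forall (d d' : measure_display) (Omega : measurableType d)
    (Omega' : measurableType d') (P : probability Omega R)
    (P' : probability Omega' R)
    (w : E -> {RV P >-> measurableTypeR R})
    (wt : E -> {RV P' >-> measurableTypeR R}),
  iid_weights nu w -> iid_weights nut wt ->
  (0 < liminf_dist (fun x y =>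
     (mean_passage_time w x y - mean_passage_time wt x y)
       * ((dist G x y)%:R^-1)%:E))%E.

End FPP.

(* Main.v *)
From HB Require Import structures.
Require Import Defs.
From mathcomp Require Import all_boot all_order all_algebra finmap.
From mathcomp Require Import all_classical all_reals all_analysis.
From mathcomp Require Import measurable_realfun.
From mathcomp Require Import ring lra zify.
Import Order.TTheory GRing.Theory Num.Theory.
Import numFieldNormedType.Exports.

Set Implicit Arguments.
Unset Strict Implicit.
Unset Printing Implicit Defensive.

Local Open Scope classical_set_scope.
Local Open Scope ring_scope.

(** If [G] does not admit detours, then for some [eps > 0] there are self-avoiding
    paths [p] of every positive length such that each other self-avoiding path [q]
    with the same ends satisfies [#|q \ p| > (1 + eps) * #|p \ q|]
    ([undetoured_exists]).  Two consequences follow for such a path, from [x] to [y]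
    say.  It is a shortest path, so [d(x, y)] is its length ([undetoured_dist]).  And
    if all edge weights lie in [[lo, hi]] with [hi <= (1 + eps) * lo], then replacing
    [p] by [q] never pays, so that [T(x, y)] is the total weight of [p]
    ([undetoured_passage_time]); under independent weights with such a law its mean
    depends on the law only through the mean of one weight
    ([mean_passage_time_undetoured]).

    It therefore suffices to find two different laws on [[1, 1 + eps]] with the same
    mean, one more variable than the other.  Take a law [mu] on [[-1, 1]] of mean [0]
    and compare the laws of [c + s * z] and [c + r * z] with [z] of law [mu] and
    [0 < s < r].  A concave [f] has a supergradient at [c], which gives
    [f (c + r * z) <= f (c + s * z) + k * z] with [k] independent of [z]
    ([concave_spread_le]); integrating removes the linear term
    ([spread_more_variable]).  With [mu] uniform on [[-1, 1]] both laws are atomless,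
    which proves the first part.

    Refuting the vdBK property also requires independent weights to exist for each of
    the two laws, and the smaller law to be exponential-subcritical.  Here [mu] is
    taken uniform on finitely many equally spaced points.  Independent weights are
    then read off the digits of a uniform point of the unit interval, one digit for
    each edge ([digits_prob], [grid_weights_exist]).  The atoms are as small as
    desired, while the geodesic threshold is positive when the degrees are bounded by
    [D]: there are at most [D ^ n] walks of length [n] from a given vertex, so a union
    bound gives exponential decay at small densities ([pc_geo_low_gt0]). *)

(** * Paths and shortest paths *)

Section Paths.
Variables (V E : choiceType) (G : multigraph V E).

Lemma mem_edges (p : seq (E * V)) e : (e \in edges p) = (e \in unzip1 p).
Proof. by rewrite /edges in_fset. Qed.

Lemma is_path_cat x (p q : seq (E * V)) :
  is_path G x (p ++ q) = is_path G x p && is_path G (endpoint x p) q.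
Proof. by elim: p x => [|[e y] p IHp] x //=; rewrite IHp andbA. Qed.

Lemma endpoint_cat x (p q : seq (E * V)) :
  endpoint x (p ++ q) = endpoint (endpoint x p) q.
Proof. by rewrite /endpoint /unzip2 map_cat last_cat. Qed.

Lemma path_edge_boundary x (p : seq (E * V)) e :
  is_path G x p -> e \in unzip1 p ->
  forall v, v \in boundary G e -> v \in x :: unzip2 p.
Proof.
elim: p x => [|[e' y] p IHp] x //= /andP[/eqP bd pp].
rewrite inE => /orP[/eqP -> v|ep v /(IHp _ pp ep)].
  by rewrite bd !inE => /orP[] ->; rewrite ?orbT.
by rewrite !inE => ->; rewrite orbT.
Qed.

(** The edges after the first one have both ends on a tail that avoids the first
    vertex. *)
Lemma self_avoiding_uniq_edges x (p : seq (E * V)) :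
  self_avoiding G x p -> uniq (unzip1 p).
Proof.
elim: p x => [|[e y] p IHp] x // /andP[/= /andP[/eqP bd pp] /andP[xp up]].
apply/andP; split; last by apply: (IHp y); rewrite /self_avoiding pp.
apply: contra xp => /(path_edge_boundary pp); apply.
by rewrite bd !inE eqxx.
Qed.

Lemma path_length_size (p : seq (E * V)) :
  uniq (unzip1 p) -> path_length p = size p.
Proof.
move=> up; rewrite /path_length /edges card_fseq undup_id//.
by rewrite /unzip1 size_map.
Qed.

Lemma path_length_le_size (p : seq (E * V)) : (path_length p <= size p)%N.
Proof.
rewrite /path_length /edges card_fseq.
by apply: leq_trans (size_undup _) _; rewrite /unzip1 size_map.
Qed.

Lemma sub_path_length (p q : seq (E * V)) :
  {subset unzip1 p <= unzip1 q} -> (path_length p <= path_length q)%N.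
Proof.
move=> pq; apply/fsubset_leq_card/fsubsetP => e.
by rewrite !mem_edges; exact: pq.
Qed.

Lemma self_avoiding_suffix y (p : seq (E * V)) x :
  self_avoiding G y p -> x \in y :: unzip2 p ->
  exists2 q, self_avoiding G x q &
    endpoint x q = endpoint y p /\ {subset unzip1 q <= unzip1 p}.
Proof.
elim: p y => [|[e z] p IHp] y sp; first by rewrite inE => /eqP ->; exists [::].
rewrite inE => /predU1P[->|xp]; first by exists ((e, z) :: p); last split.
case/andP: sp => /= /andP[_ pp] /andP[_ up].
have [|q sq [eq sub]] := IHp z _ xp; first by rewrite /self_avoiding pp.
by exists q => //; split => // e' /sub; rewrite inE => ->; rewrite orbT.
Qed.

(** By induction the tail is already loop-erased; if the first vertex lies on it, the
    suffix that starts there does. *)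
Lemma loop_erasure x (p : seq (E * V)) : is_path G x p ->
  exists2 q, self_avoiding G x q &
    endpoint x q = endpoint x p /\ {subset unzip1 q <= unzip1 p}.
Proof.
elim: p x => [|[e y] p IHp] x /=; first by exists [::].
move=> /andP[bd /IHp[q sq [eq sub]]].
have sub' : {subset unzip1 q <= e :: unzip1 p}.
  by move=> e' /sub; rewrite inE => ->; rewrite orbT.
have [xq|xq] := boolP (x \in y :: unzip2 q).
  have [q' sq' [eq' subq]] := self_avoiding_suffix sq xq.
  by exists q' => //; split; [rewrite eq' eq|move=> e' /subq/sub'].
exists ((e, y) :: q).
  by case/andP: sq => pq uq; rewrite /self_avoiding /= bd pq xq.
split; first exact: eq.
by move=> e'; rewrite !inE => /predU1P[->|/sub ->]; rewrite ?eqxx ?orbT.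
Qed.

Lemma dist_le x y (p : seq (E * V)) :
  path_between G x y p -> (dist G x y <= path_length p)%N.
Proof.
rewrite /dist => pp; case: pselect => [ex|]; last first.
  by case; exists (path_length p); apply/asboolP; exists p.
by case: ex_minnP => m _; apply; apply/asboolP; exists p.
Qed.

Lemma dist_attained x y (p : seq (E * V)) : path_between G x y p ->
  exists2 q, path_between G x y q & path_length q = dist G x y.
Proof.
rewrite /dist => pp; case: pselect => [ex|]; last first.
  by case; exists (path_length p); apply/asboolP; exists p.
by case: ex_minnP => m /asboolP[q qp ql] _; exists q.
Qed.

Lemma self_avoiding_betweenW x y (p : seq (E * V)) :
  self_avoiding_between G x y p -> path_between G x y p.
Proof. by move=> /andP[/andP[pp _] ep]; apply/andP. Qed.

Lemma self_avoiding_length x (p : seq (E * V)) :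
  self_avoiding G x p -> path_length p = size p.
Proof. by move=> /self_avoiding_uniq_edges/path_length_size. Qed.

Lemma self_avoiding_cat x (p q : seq (E * V)) :
  self_avoiding G x (p ++ q) -> self_avoiding G x p.
Proof.
rewrite /self_avoiding is_path_cat => /andP[/andP[-> _]] /=.
by rewrite /unzip2 map_cat mem_cat cat_uniq negb_or => /andP[/andP[-> _] /andP[-> _]].
Qed.

Lemma edge_geodesic_dist x (p : seq (E * V)) :
  edge_geodesic G x p -> path_length p = dist G x (endpoint x p).
Proof.
move=> [pp geo].
have pb : path_between G x (endpoint x p) p by rewrite /path_between pp eqxx.
apply/eqP; rewrite eqn_leq dist_le// andbT.
by have [q qb <-] := dist_attained pb; exact: geo.
Qed.

(** Lengths count distinct edges, so a geodesic may retrace its steps: it is first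
    loop-erased, then cut after [r.+1] steps, since prefixes of shortest paths are
    shortest. *)
Lemma escaping_geodesic_prefix (S : E -> bool) o r :
  escapes G (edge_geodesic G) S o r ->
  exists p, [/\ self_avoiding G o p, size p = r.+1,
    edge_geodesic G o p & forall e, e \in edges p -> S e].
Proof.
move=> [p [pp open /negP]]; rewrite -ltnNge => far geo.
have [q sq [eq sub]] := loop_erasure pp.
have lq : path_length q = size q by exact: self_avoiding_length sq.
have rq : (r < size q)%N.
  rewrite -lq (leq_trans far)// -eq dist_le//.
  by case/andP: sq => pq _; rewrite /path_between pq eqxx.
pose q1 := take r.+1 q; pose q2 := drop r.+1 q.
have q12 : q = q1 ++ q2 by rewrite cat_take_drop.
have sq1 : self_avoiding G o q1 by move: sq; rewrite q12 => /self_avoiding_cat.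
have pq1 : is_path G o q1 by case/andP: sq1.
exists q1; split=> //; first by rewrite size_takel.
  split=> // q' /andP[pq' /eqP eq'].
  have : path_between G o (endpoint o p) (q' ++ q2).
    case/andP: sq => pq _; move: pq eq; rewrite q12 is_path_cat endpoint_cat.
    move=> /andP[_ pq2] <-.
    by rewrite /path_between is_path_cat pq' eq' pq2 endpoint_cat eq' eqxx.
  move=> /(proj2 geo); rewrite (self_avoiding_length sq1) => le1.
  have := sub_path_length sub; rewrite lq q12 size_cat => le2.
  have : (path_length (q' ++ q2) <= path_length q' + size q2)%N.
    rewrite (leq_trans _ (leq_add (leqnn _) (path_length_le_size q2)))//.
    rewrite (leq_trans _ (leq_card_fsetU _ _))//.
    apply/fsubset_leq_card/fsubsetP => e.
    by rewrite in_fsetU !mem_edges /unzip1 map_cat mem_cat.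
  by move: le1 le2; set a := path_length p; set b := path_length (q' ++ q2); lia.
move=> e; rewrite mem_edges => eq1; apply: open; rewrite mem_edges.
by apply: sub; rewrite q12 /unzip1 map_cat mem_cat eq1.
Qed.

End Paths.

(** * Counting walks; paths without detours *)

Section Counting.
Variables (V E : choiceType) (G : multigraph V E).
Hypothesis lf : locally_finite G.

(** The default [o] is never reached: a boundary has two elements. *)
Definition other_end (o : V) (e : E) : V := head o (enum_fset (boundary G e `\ o)%fset).

Lemma other_endE o e y : boundary G e = [fset o; y]%fset -> other_end o e = y.
Proof.
move=> bd; have := card_boundary G e.
rewrite bd cardfs2 /other_end bd.
case: (eqVneq o y) => //= oy _; rewrite fsetU1K ?inE//.
have : size (enum_fset [fset y]%fset) = 1%N by exact: cardfs1.
have : forall z, z \in enum_fset [fset y]%fset -> z = y by move=> z /fset1P.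
by case: (enum_fset _) => [|z []] // /(_ z (mem_head _ _)).
Qed.

Fixpoint walks (n : nat) (o : V) : seq (seq (E * V)) :=
  if n is n'.+1 then
    [seq (e, other_end o e) :: q | e <- enum_fset (fset_set (incident G o)),
                                   q <- walks n' (other_end o e)]
  else [:: [::]].

Lemma mem_walks n o (p : seq (E * V)) :
  is_path G o p -> size p = n -> p \in walks n o.
Proof.
elim: n o p => [|n IHn] o [|[e y] p] //= /andP[/eqP bd pp] [sp].
apply/allpairsPdep; exists e, p; rewrite (other_endE bd); split => //.
  rewrite in_fset_set; last exact: lf.
  by rewrite inE /incident/= bd !inE eqxx.
exact: IHn.
Qed.

Lemma size_walks D n o : (forall v, (degree G v <= D)%N) ->
  (size (walks n o) <= D ^ n)%N.
Proof.
move=> deg; elim: n o => [|n IHn] o //=.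
rewrite size_allpairs_dep expnS.
apply: (@leq_trans (\sum_(e <- enum_fset (fset_set (incident G o))) D ^ n)).
  rewrite sumnE big_map; apply: leq_sum => e _; exact: IHn.
rewrite big_const_seq count_predT iter_addn_0 mulnC leq_mul2r.
by rewrite [X in _ || X]deg orbT.
Qed.

End Counting.

(** Each edge is incident to some vertex, each vertex to finitely many edges. *)
Lemma countable_edges (V E : choiceType) (G : multigraph V E) :
  locally_finite G -> countable [set: V] -> countable [set: E].
Proof.
move=> lf cV; apply: (@sub_countable _ _ _ (\bigcup_v incident G v)); last first.
  by apply: bigcup_countable => // v _; exact: finite_set_countable (lf v).
apply: subset_card_le => e _.
have /fset0Pn[v ve] : boundary G e != fset0.
  by rewrite -cardfs_gt0 card_boundary.
by exists v.
Qed.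

Lemma countable_seq (T : choiceType) :
  countable [set: T] -> countable [set: seq T].
Proof.
move=> /countable_injP[f /in2TT finj].
have minj : injective (map f) by apply: inj_map.
apply/countable_injP; exists (fun s => CodeSeq.code (map f s)) => s t _ _.
by move=> /(can_inj CodeSeq.codeK) /minj.
Qed.

Lemma countable_paths (V E : choiceType) (G : multigraph V E) :
  locally_finite G -> countable [set: V] -> countable [set: seq (E * V)].
Proof.
move=> lf cV; apply: countable_seq.
have /countable_injP[f /in2TT finj] := countable_edges lf cV.
have /countable_injP[g /in2TT ginj] := cV.
apply/countable_injP; exists (fun z => CodeSeq.code [:: f z.1; g z.2]) => -[e v] [e' v'] _ _.
by move=> /(can_inj CodeSeq.codeK) [/finj -> /ginj ->].
Qed.

Lemma sum_const_fset (R : nmodType) (T : choiceType) (A : {fset T}) (c : R) :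
  \sum_(i <- A) c = c *+ #|` A|%fset.
Proof. by rewrite big_const_seq count_predT iter_addr_0. Qed.

Section NoDetour.
Variables (R : realType) (V E : choiceType) (G : multigraph V E).

(** What the failure of the detour property provides at every length. *)
Definition undetoured (eps : R) (x : V) (p : seq (E * V)) : Prop :=
  self_avoiding G x p /\
  forall q, self_avoiding_between G x (endpoint x p) q -> edges p != edges q ->
    (1 + eps) * #|` edges p `\` edges q|%fset%:R < #|` edges q `\` edges p|%fset%:R.

Lemma undetoured_exists : ~ admits_detours G R ->
  exists2 eps : R, 0 < eps &
    forall n, exists x p, undetoured eps x p /\ path_length p = n.+1.
Proof.
move=> /existsNP[eps /not_implyP[eps0 nd]]; exists eps => // n.
apply: contrapT => none; apply: nd; exists n.+1 => // x p sp lp.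
apply: contrapT => nd; apply: none; exists x, p; split=> //; split=> // q.
move=> qb npq; rewrite ltNge; apply/negP => le; apply: nd; exists q.
  by case/andP: qb.
by split => //; exact: self_avoiding_betweenW.
Qed.

Variables (eps : R) (x : V) (p : seq (E * V)).
Hypotheses (eps0 : 0 < eps) (und : undetoured eps x p).

Let between : self_avoiding_between G x (endpoint x p) p.
Proof. by rewrite /self_avoiding_between eqxx und.1. Qed.

(** A loop-erased shortest path that differs from [p] has more edges outside [p] than
    [p] has outside it, so it is not shorter. *)
Lemma undetoured_dist : dist G x (endpoint x p) = path_length p.
Proof.
apply/eqP; rewrite eqn_leq dist_le ?self_avoiding_betweenW//=.
have [q0 /andP[pq0 /eqP eq0] <-] := dist_attained (self_avoiding_betweenW between).
have [q sq [eq sub]] := loop_erasure pq0.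
apply: leq_trans (sub_path_length sub).
have qb : self_avoiding_between G x (endpoint x p) q.
  by rewrite /self_avoiding_between sq eq eq0 eqxx.
have [eqe|neqe] := eqVneq (edges p) (edges q); first by rewrite /path_length eqe.
have := und.2 _ qb neqe; set a := #|` _|%fset; set b := #|` _|%fset => ab.
have {}ab : (a <= b)%N.
  rewrite -(ler_nat R) (le_trans _ (ltW ab))// ler_peMl// lerDl ltW//.
rewrite /path_length -(cardfsID (edges q) (edges p)) -(cardfsID (edges p) (edges q)).
by rewrite fsetIC leq_add2l.
Qed.

(** Replacing [p] by another path [q] loses at most [hi] per edge of [p] outside
    [q], and gains at least [lo] per edge of [q] outside [p]. *)
Lemma undetoured_path_time_min (lo hi : R) (w : E -> R) q :
  0 < lo -> hi <= (1 + eps) * lo -> (forall e, lo <= w e <= hi) ->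
  self_avoiding_between G x (endpoint x p) q -> path_time w p <= path_time w q.
Proof.
move=> lo0 hilo wb qb.
have [eqe|neqe] := eqVneq (edges p) (edges q); first by rewrite /path_time eqe.
have split_time (r s : seq (E * V)) : path_time w r =
    \sum_(e <- (edges r `&` edges s)%fset) w e + \sum_(e <- (edges r `\` edges s)%fset) w e.
  rewrite /path_time (big_fsetID _ (mem (edges s))) /=.
  by congr (_ + _); apply: eq_fbigl => e; rewrite !inE //= andbC.
rewrite (split_time p q) (split_time q p) fsetIC lerD2l.
have up : \sum_(e <- (edges p `\` edges q)%fset) w e
    <= hi * #|` edges p `\` edges q|%fset%:R.
  rewrite mulr_natr -sum_const_fset.
  by apply: ler_sum => e _; case/andP: (wb e).
have low : lo * #|` edges q `\` edges p|%fset%:R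
    <= \sum_(e <- (edges q `\` edges p)%fset) w e.
  rewrite mulr_natr -sum_const_fset.
  by apply: ler_sum => e _; case/andP: (wb e).
apply: le_trans up (le_trans _ low).
apply: le_trans (ler_wpM2r _ hilo) _; first exact: ler0n.
by rewrite mulrAC mulrC ler_pM2l// ltW// und.2.
Qed.

Lemma undetoured_passage_time (lo hi : R) (w : E -> R) :
  0 < lo -> hi <= (1 + eps) * lo -> (forall e, lo <= w e <= hi) ->
  passage_time G w x (endpoint x p) = path_time w p.
Proof.
move=> lo0 hilo wb.
rewrite /passage_time; set A := (X in inf X).
have Ap : A (path_time w p) by exists p.
have lbA : lbound A (path_time w p).
  by move=> _ [q qb <-]; exact: undetoured_path_time_min lo0 hilo wb qb.
apply/eqP; rewrite eq_le; apply/andP; split.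
  by apply: inf_lbound => //; exists (path_time w p).
by apply: lb_le_inf => //; exists (path_time w p).
Qed.

End NoDetour.

(** * Concave functions and laws on an interval *)

Section Concave.
Variable R : realType.

Lemma concaveP (f : R -> R) (t x y : R) : concave f -> 0 <= t <= 1 ->
  t * f x + (1 - t) * f y <= f (t * x + (1 - t) * y).
Proof.
move=> cf /andP[t0 t1].
have : - f (t * x + (1 - t) * y) <= t * - f x + (1 - t) * - f y.
  by apply: (cf (Itv01 t0 t1)); rewrite inE.
by rewrite !mulrN -opprD lerN2.
Qed.

(** The slopes of a concave function to the right of [c] are bounded by each slope
    to the left of [c], so their supremum is a supergradient. *)
Lemma concave_supergradient (f : R -> R) (c : R) : concave f ->
  exists k, forall x, f x <= f c + k * (x - c).
Proof.
move=> cf; pose S := [set (f x - f c) / (x - c) | x in [set x | c < x]].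
have slope x y : y < c -> c < x -> (f x - f c) / (x - c) <= (f c - f y) / (c - y).
  move=> yc cx; have cy0 : 0 < c - y by rewrite subr_gt0.
  have xc0 : 0 < x - c by rewrite subr_gt0.
  have xy0 : 0 < x - y by lra.
  rewrite ler_pdivrMr// mulrAC ler_pdivlMr//.
  pose t := (c - y) / (x - y).
  have t01 : 0 <= t <= 1.
    by rewrite divr_ge0 ?(ltW cy0) ?(ltW xy0)//= ler_pdivrMr// mul1r; lra.
  have := concaveP x y cf t01.
  have tE : t * (x - y) = c - y by rewrite divfK// gt_eqF.
  have -> : t * x + (1 - t) * y = c by rewrite mulrBl mul1r addrCA -mulrBr tE; lra.
  move=> /(ler_wpM2r (ltW xy0)).
  have tE' : (1 - t) * (x - y) = x - c by rewrite mulrBl mul1r tE; lra.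
  by rewrite mulrDl mulrAC tE [_ * f y * _]mulrAC tE'; lra.
have S0 : S !=set0 by exists ((f (c + 1) - f c) / (c + 1 - c)), (c + 1) => //=; lra.
have bS y : y < c -> ubound S ((f c - f y) / (c - y)).
  by move=> yc _ [x /= cx <-]; exact: slope.
exists (sup S) => x; have [xc|cx|->] := ltgtP x c; last by rewrite subrr mulr0 addr0.
  have := ge_sup S0 (bS _ xc); rewrite ler_pdivlMr; last lra.
  lra.
have : (f x - f c) / (x - c) <= sup S.
  apply: sup_upper_bound; last by exists x.
  by split=> //; exists ((f c - f (c - 1)) / (c - (c - 1))); apply: bS; lra.
by rewrite ler_pdivrMr; lra.
Qed.

(** Concavity between [c] and [c + r * z] bounds the increment of [f] from [c + s * z]
    to [c + r * z] by [1 - s / r] times the increment from [c], which a supergradient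
    at [c] bounds linearly. *)
Lemma concave_spread_le (f : R -> R) (c r s : R) : concave f -> 0 <= s -> s < r ->
  exists k, forall z, f (c + r * z) <= f (c + s * z) + k * z.
Proof.
move=> cf s0 sr; have r0 : 0 < r by exact: le_lt_trans sr.
have [k fk] := concave_supergradient c cf.
exists ((1 - s / r) * (k * r)) => z.
have t01 : 0 <= s / r <= 1.
  by rewrite divr_ge0 ?(ltW r0)//= ler_pdivrMr// mul1r ltW.
have := concaveP (c + r * z) c cf t01.
have -> : s / r * (c + r * z) + (1 - s / r) * c = c + s * z.
  by rewrite mulrDr mulrA divfK ?gt_eqF// mulrBl mul1r; lra.
have := fk (c + r * z); rewrite addrAC subrr add0r => fr.
have : (1 - s / r) * f (c + r * z) <= (1 - s / r) * (f c + k * (r * z)).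
  by apply: ler_wpM2l => //; case/andP: t01; rewrite subr_ge0.
lra.
Qed.

End Concave.

Section Concentrated.
Variables (R : realType) (nu : probability (measurableTypeR R) R) (a b : R).
Hypothesis nuab : nu `[a, b]%classic = 1%E.

Let mitv : measurable (`[a, b]%classic : set (measurableTypeR R)).
Proof. exact: measurable_itv. Qed.

Lemma concentrated_setC0 : nu (~` `[a, b]%classic) = 0%E.
Proof. by rewrite probability_setC// nuab subee. Qed.

Lemma concentrated_negligible : nu.-negligible (~` `[a, b]%classic).
Proof.
by exists (~` `[a, b]%classic); split => //;
  [exact: measurableC|exact: concentrated_setC0].
Qed.

Lemma concentrated_null (A : set (measurableTypeR R)) :
  measurable A -> A `<=` ~` `[a, b] -> nu A = 0%E.
Proof.
move=> mA Aab; apply/eqP; rewrite eq_le measure_ge0 andbT.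
by rewrite -concentrated_setC0 le_measure ?inE//; exact: measurableC.
Qed.

Lemma concentrated_support : law_support nu `<=` `[a, b].
Proof.
move=> x sx; apply: contrapT => xab.
have /sx : open (~` `[a, b]%classic) by apply/closed_openC/itv_closed.
by move=> /(_ xab); rewrite concentrated_setC0 ltxx.
Qed.

Lemma concentrated_nonneg : 0 <= a -> on_nonneg nu.
Proof.
have m0 : measurable (`[0, +oo[%classic : set (measurableTypeR R)).
  exact: measurable_itv.
move=> a0; apply/eqP; rewrite eq_le probability_le1//= -nuab le_measure ?inE//.
by move=> x /=; rewrite !in_itv/= andbT => /andP[/(le_trans a0)].
Qed.

Lemma concentrated_away0 : 0 < a -> supported_away_from0 nu.
Proof.
exists a => // x /concentrated_support /=; rewrite !in_itv/= andbT.
by case/andP.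
Qed.

Lemma concentrated_mean : finite_mean nu.
Proof.
have mC : measurable (~` `[a, b]%classic : set (measurableTypeR R)) by exact: measurableC.
rewrite /finite_mean.
apply: (iffRL (negligible_integrable mC measurableT _ concentrated_setC0)).
  exact/measurable_EFinP.
rewrite setDE setCK setTI.
apply: measurable_bounded_integrable => //.
- by apply: (le_lt_trans (probability_le1 nu mitv)); exact: ltry.
- exists (`|a| + `|b|); split; first by rewrite num_real.
  move=> M M0 x /=; rewrite in_itv/= => /andP[ax xb].
  apply: le_trans (ltW M0); rewrite ler_norml.
  have := ler_norm b; have := ler_norm (- a); rewrite normrN.
  have := normr_ge0 a; have := normr_ge0 b; lra.
Qed.

End Concentrated.

(** * Spreading a centred law *)

Section Affine.
Variables (R : realType) (c r : R).

Definition affine (x : measurableTypeR R) : measurableTypeR R := c + r * x.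

Lemma measurable_affine : measurable_fun [set: measurableTypeR R] affine.
Proof.
apply: measurable_funD; first exact: measurable_cst.
by apply: measurable_funM; [exact: measurable_cst|exact: measurable_id].
Qed.

HB.instance Definition _ :=
  isMeasurableFun.Build _ _ _ _ affine measurable_affine.

End Affine.

Lemma affine_inv (R : realType) (c r x : R) : r != 0 ->
  affine (- (c / r)) r^-1 (affine c r x) = x.
Proof. by move=> r0; rewrite /affine; field. Qed.

(** Integrability is required of the law, where boundedness of the support provides
    it. *)
Lemma integral_law d (Omega : measurableType d) (R : realType)
    (P : probability Omega R) (X : {RV P >-> measurableTypeR R}) (f : R -> R) :
  (distribution P X).-integrable [set: R] (EFin \o f) ->
  P.-integrable [set: Omega] (EFin \o (f \o X)) /\
  (\int[distribution P X]_x (f x)%:E = \int[P]_x (f (X x))%:E)%E.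
Proof.
move=> fi; have mf := measurable_int _ fi.
have fi' : P.-integrable [set: Omega] (EFin \o (f \o X)).
  apply/integrableP; split; first exact: measurableT_comp mf (measurable_funPT X).
  case/integrableP: fi => _.
  rewrite (@ge0_integral_distribution _ _ _ _ _ P X (fun y => `|(f y)%:E|%E))//.
  exact: measurableT_comp.
split => //.
by rewrite (@integral_distribution _ _ _ _ _ P X (EFin \o f)).
Qed.

Section Spread.
Variables (R : realType) (mu : probability (measurableTypeR R) R).

Definition spread (c r : R) : probability (measurableTypeR R) R :=
  distribution mu (affine c r).

Lemma spreadE c r A : spread c r A = mu (affine c r @^-1` A).
Proof. by []. Qed.

Lemma measurable_preimage_affine c r (A : set (measurableTypeR R)) :
  measurable A -> measurable (affine c r @^-1` A).
Proof. by move=> mA; rewrite -[X in measurable X]setTI; exact: measurable_affine. Qed.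

Lemma atomless_spread c r : r != 0 -> atomless mu -> atomless (spread c r).
Proof.
move=> r0 amu A mA; rewrite spreadE => A0.
have [B [mB BA] BB] := amu _ (measurable_preimage_affine c r mA) A0.
have BE : affine c r @^-1` (affine (- (c / r)) r^-1 @^-1` B) = B.
  by apply/seteqP; split => x /=; rewrite affine_inv.
exists (affine (- (c / r)) r^-1 @^-1` B); last by rewrite !spreadE BE.
split; first exact: measurable_preimage_affine.
move=> y /= /BA /=; rewrite /affine (_ : c + _ = y)//; field => //.
Qed.

Hypothesis mu1 : mu `[-1, 1]%classic = 1%E.

Lemma spread_concentrated c r : 0 <= r -> spread c r `[c - r, c + r]%classic = 1%E.
Proof.
move=> r0; have m1 : measurable (`[-1, 1]%classic : set (measurableTypeR R)).
  exact: measurable_itv.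
have mI : measurable (`[c - r, c + r]%classic : set (measurableTypeR R)).
  exact: measurable_itv.
have mA := measurable_preimage_affine c r mI.
apply/eqP; rewrite eq_le probability_le1//= spreadE -mu1 le_measure ?inE//.
move=> x /=; rewrite !in_itv/= /affine => /andP[x0 x1].
by apply/andP; split; nra.
Qed.

Hypothesis mean0 : (\int[mu]_x x%:E = 0)%E.

Lemma spread_mean c r : 0 <= r -> (\int[spread c r]_x x%:E = c%:E)%E.
Proof.
move=> r0; have [_ ->] := integral_law (concentrated_mean (spread_concentrated c r0)).
have ix := concentrated_mean mu1.
under eq_integral do rewrite EFinD EFinM.
rewrite integralD//=; last 2 first.
- exact: finite_measure_integrable_cst.
- exact: integrableZl.
rewrite integral_cst// [X in (_ * X)%E](probability_setT mu) mule1.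
by rewrite integralZl// mean0 mule0 adde0.
Qed.

(** Integrating [concave_spread_le]: the linear term vanishes as [mu] has mean 0. *)
Lemma spread_more_variable c r s : 0 <= s -> s < r ->
  more_variable (spread c r) (spread c s).
Proof.
move=> s0 sr f cf _ ir i_s.
have [fr] := @integral_law _ _ _ mu (affine c r) f ir.
have [fs] := @integral_law _ _ _ mu (affine c s) f i_s.
rewrite /spread => -> ->.
have [k fk] := concave_spread_le c cf s0 sr.
have ix := concentrated_mean mu1.
have ik : mu.-integrable [set: R] (fun x => k%:E * x%:E)%E by exact: integrableZl.
have -> : (\int[mu]_x (f (c + s * x))%:E =
    \int[mu]_x ((f (c + s * x))%:E + k%:E * x%:E))%E.
  by rewrite integralD//= integralZl// mean0 mule0 adde0.
apply: le_integral; [by []|exact: fr|exact: integrableD|].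
by move=> x _; rewrite -EFinM -EFinD lee_fin; exact: fk.
Qed.

(** Only the wider of the two laws charges the points beyond [c + s]. *)
Lemma spread_strictly_more_variable (c r s : R) : 0 < s -> s < r ->
  (0 < mu `](s / r)%R, +oo[%classic)%E ->
  strictly_more_variable (spread c r) (spread c s).
Proof.
move=> s0 sr tail; split; first exact: spread_more_variable (ltW s0) sr.
have r0 : 0 < r by exact: lt_trans sr.
have mI : measurable (`]c + s, +oo[%classic : set (measurableTypeR R)).
  exact: measurable_itv.
exists `]c + s, +oo[%classic => //.
rewrite (concentrated_null (spread_concentrated c (ltW s0)))//; last first.
  by move=> x /=; rewrite !in_itv/= andbT => cx /andP[_]; rewrite leNgt cx.
rewrite spreadE => mu0; move: tail.
rewrite (_ : `]s / r, +oo[%classic = affine c r @^-1` `]c + s, +oo[) ?mu0 ?ltxx//.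
apply/seteqP; split => x /=; rewrite !in_itv/= !andbT /affine ltrD2l.
  by rewrite ltr_pdivrMr// mulrC.
by rewrite ltr_pdivrMr// mulrC.
Qed.

End Spread.

(** * The uniform law on an interval *)

Section Uniform.
Variable R : realType.
Local Notation leb := (@lebesgue_measure R).

Lemma uniform_probE (a b : R) (ab : a < b) (A : set (measurableTypeR R)) :
  measurable A -> uniform_prob ab A = ((b - a)^-1%:E * leb (A `&` `[a, b]))%E.
Proof.
move=> mA; rewrite /uniform_prob integral_uniform_pdf.
rewrite (eq_integral (fun=> (b - a)^-1%:E)); last first.
  by move=> x; rewrite inE /= in_itv/= /uniform_pdf => -[_ ->].
by rewrite integral_cst//; exact: measurableI.
Qed.

Lemma uniform_prob_itv (a b x y : R) (ab : a < b) (l r : bool) :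
  a <= x -> x <= y -> y <= b ->
  uniform_prob ab [set` Interval (BSide l x) (BSide r y)] = ((y - x) / (b - a))%:E.
Proof.
move=> ax xy yb; rewrite uniform_probE ?setIidl; last exact: measurable_itv.
  rewrite [leb _]lebesgue_measure_itv/= lte_fin.
  case: ltgtP xy => // [_ _|-> _]; first by rewrite -EFinB -EFinM mulrC.
  by rewrite mule0 subrr mul0r.
move=> z; rewrite /= !itv_boundlr/= => /andP[xz zy].
apply/andP; split; first by apply: le_trans xz; case: l; rewrite bnd_simp.
by apply: le_trans zy _; case: r; rewrite bnd_simp.
Qed.

Lemma uniform_prob_itvT (a b : R) (ab : a < b) : uniform_prob ab `[a, b]%classic = 1%E.
Proof.
by rewrite uniform_prob_itv// ?ltW// divff// subr_eq0 gt_eqF.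
Qed.

(** Some cell of a fine grid meets [A] in positive mass, and each cell has less mass
    than [A]. *)
Lemma atomless_uniform (a b : R) (ab : a < b) : atomless (uniform_prob ab).
Proof.
move=> A mA A0; set mu := uniform_prob ab.
have Afin : mu A \is a fin_num by exact: fin_num_measure.
pose e := fine (mu A); have e0 : 0 < e by rewrite fine_gt0// A0 ltey_eq Afin.
have ba0 : 0 < b - a by rewrite subr_gt0.
have d0 : 0 < e / 2 * (b - a) by rewrite mulr_gt0// divr_gt0.
(* the width makes the mass of a cell at most e / 2 *)
pose cell k := `[a, b] `&` `[a + e / 2 * (b - a) * k%:R, a + e / 2 * (b - a) * k.+1%:R]%classic.
have mcell k : measurable (cell k : set (measurableTypeR R)).
  by apply: measurableI; exact: measurable_itv.
have cell_small k : (mu (cell k) < mu A)%E.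
  have -> : mu A = e%:E by rewrite /e fineK.
  rewrite [mu _]uniform_probE//.
  apply: (@le_lt_trans _ _ ((b - a)^-1%:E * (e / 2 * (b - a))%:E))%E; last first.
    by rewrite -EFinM lte_fin mulrC mulfK ?gt_eqF//; lra.
  apply: lee_wpmul2l; first by rewrite lee_fin invr_ge0 ltW.
  set I := `[a + e / 2 * (b - a) * k%:R, a + e / 2 * (b - a) * k.+1%:R]%classic.
  apply: (@le_trans _ _ (leb I)).
    rewrite le_measure ?inE//.
    - by apply: measurableI; [exact: mcell|exact: measurable_itv].
    - exact: measurable_itv.
    - by move=> x [[]].
  rewrite lebesgue_measure_itv/= lte_fin; case: ifPn => _.
    by rewrite -EFinB lee_fin -natr1; lra.
  by rewrite lee_fin ltW.
pose B k := A `&` cell k.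
have mB k : measurable (B k : set (measurableTypeR R)) by exact: measurableI.
have [[k Bk]|none] := pselect (exists k, mu (B k) != 0%E).
  exists (B k); first by split; [exact: mB|move=> x []].
  rewrite lt0e Bk measure_ge0/=; apply: le_lt_trans (cell_small k).
  by apply: le_measure => [||x []//]; apply/mem_set; [exact: mB|exact: mcell].
have Bnull k : mu.-negligible (B k).
  exists (B k); split => //; apply: contrapT => /eqP B0; apply: none.
  by exists k.
have Cnull : mu.-negligible (~` `[a, b]%classic).
  exact: concentrated_negligible (uniform_prob_itvT ab).
have : mu.-negligible A.
  apply: negligibleS (negligibleU Cnull (negligible_bigcup Bnull)) => x Ax.
  have [xab|] := pselect (`[a, b]%classic x); last by left.
  right; move: (xab); rewrite /= in_itv/= => /andP[ax xb].
  have x0 : 0 <= (x - a) / (e / 2 * (b - a)) by rewrite divr_ge0 ?subr_ge0// ltW.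
  have /andP[lo hi] := Num.Theory.truncn_itv x0.
  exists (Num.truncn ((x - a) / (e / 2 * (b - a)))) => //; split=> //; split => //=.
  move: lo hi; rewrite ler_pdivlMr// ltr_pdivrMr// in_itv/= => lo hi.
  by apply/andP; split; lra.
by move=> /(negligibleP mu mA) muA0; move: A0; rewrite -/mu [X in (_ < X)%E]muA0 ltxx.
Qed.

Lemma ltN11 : -1 < 1 :> R. Proof. by lra. Qed.

Lemma uniform_mean : (\int[uniform_prob ltN11]_x x%:E = 0)%E.
Proof.
set mu := uniform_prob _; have mu1 := uniform_prob_itvT ltN11.
have ix : mu.-integrable [set: R] (fun x => x%:E) := concentrated_mean mu1.
have i1 : mu.-integrable [set: R] (fun=> 1%E) by exact: finite_measure_integrable_cst.
(* the density formula for integrals is for nonnegative functions, hence a shift *)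
pose g (x : R) := Num.max (x + 1) 0.
have mg : measurable_fun [set: R] g by apply: measurable_maxr => //; exact: measurable_funD.
have shift : (\int[mu]_x (g x)%:E = \int[mu]_x x%:E + 1)%E.
  transitivity (\int[mu]_x (x%:E + 1%E))%E; last first.
    by rewrite integralD// integral_cst// mul1e [X in (_ + X)%E](probability_setT mu).
  apply: ae_eq_integral => //; [exact/measurable_EFinP|exact/measurable_EFinP/measurable_funD|].
  apply: negligibleS (concentrated_negligible mu1) => x /=.
  apply: contra_not => /=; rewrite in_itv/= => /andP[x1 _] _.
  by rewrite /g max_l//; lra.
have : (\int[mu]_x (g x)%:E = 1)%E.
  have mg' : measurable_fun [set: R] (EFin \o g) by exact/measurable_EFinP.
  have g0 x : (0 <= (EFin \o g) x)%E by rewrite lee_fin /g le_max lexx orbT.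
  have -> := integral_uniform ltN11 mg' g0.
  have -> : (\int[leb]_(x in `[(-1)%R, 1%R]) (EFin \o g) x =
      \int[leb]_(x in `[(-1)%R, 1%R]) ((('X + 1%:P : {poly R}).[x])%:E))%E.
    apply: eq_integral => x; rewrite inE/= in_itv/= => /andP[x1 _].
    by rewrite !hornerE /g max_l//; lra.
  pose F : {poly R} := 2^-1%:P * ('X + 1%:P) ^+ 2.
  have F1 : F.[1] = 2 by rewrite /F !hornerE /=; lra.
  have FN1 : F.[-1] = 0 by rewrite /F !hornerE /=; lra.
  rewrite (@continuous_FTC2 _ _ (horner F))//.
  - rewrite F1 FN1 -EFinB -EFinM; congr EFin.
    have -> : 1 - -1 = 2 :> R by lra.
    by rewrite subr0 mulVf.
  - exact/continuous_subspaceT/continuous_horner.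
  - split.
    + by move=> x _; exact: derivable_horner.
    + by apply: cvg_at_right_filter; exact: continuous_horner.
    + by apply: cvg_at_left_filter; exact: continuous_horner.
  - move=> x _; rewrite -derivE /F mul_polyC derivZ deriv_exp.
    rewrite derivD derivX derivC addr0 mul1r expr1 hornerZ hornerMn; lra.
by rewrite shift => /(congr1 (fun t => t - 1)%E); rewrite addeK// subee.
Qed.

End Uniform.

(** * Mean passage time between the ends of a path without detours *)

Lemma countable_negligible d (T : measurableType d) (R : realType)
    (mu : {measure set T -> \bar R}) (I : choiceType) (F : I -> set T) :
  countable [set: I] -> (forall i, mu.-negligible (F i)) ->
  mu.-negligible (\bigcup_i F i).
Proof.
move=> cI F0; pose N i := sval (cid (F0 i)).
have NP i : [/\ measurable (N i), mu (N i) = 0%E & F i `<=` N i] :=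
  svalP (cid (F0 i)).
have /countable_injP[f /in2TT finj] := cI.
have sub : \bigcup_i F i `<=` \bigcup_n \bigcup_(i in [set i | f i = n]) F i.
  by move=> x [i _ Fx]; exists (f i) => //; exists i.
apply: negligibleS sub (negligible_bigcup _) => n.
have [[i fi]|none] := pselect (exists i, f i = n).
  by apply: negligibleS (F0 i) => x [j /= fj Fj]; have -> : i = j by apply: finj; rewrite fi.
apply: negligibleS (negligible_set0 mu) => x [i /= fi _]; apply: none.
by exists i.
Qed.

Section PassageTime.
Variables (R : realType) (V E : choiceType) (G : multigraph V E).
Context d (Omega : measurableType d) (P : probability Omega R).
Variable w : E -> {RV P >-> measurableTypeR R}.
Hypothesis w0 : forall e om, 0 <= w e om.

Lemma measurable_path_time (p : seq (E * V)) :
  measurable_fun [set: Omega] (fun om => path_time (fun e => w e om) p).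
Proof. by apply: measurable_sum => e; exact: (measurable_funPT (w e)). Qed.

(** The passage time is below [c] exactly when the travel time along one of countably
    many paths is. *)
Lemma measurable_passage_time x y (p0 : seq (E * V)) :
  countable [set: seq (E * V)] -> self_avoiding_between G x y p0 ->
  measurable_fun [set: Omega] (fun om => passage_time G (fun e => w e om) x y).
Proof.
move=> cp p0b; apply: (measurability _ (RGenInftyO.measurableE R)) => //.
move=> _ [_ [c ->] <-]; rewrite setTI.
pose F p := [set om | self_avoiding_between G x y p /\
                      path_time (fun e => w e om) p < c].
rewrite (_ : _ @^-1` _ = \bigcup_p F p); last first.
  apply/seteqP; split => om /=; rewrite in_itv/= /passage_time.
    move=> /inf_lt[|_ [p pb <-] ltc]; last by exists p.
    by exists (path_time (fun e => w e om) p0), p0.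
  move=> [p _ [pb ltc]]; apply: le_lt_trans ltc.
  apply: inf_lbound; last by exists p.
  by exists 0 => _ [q _ <-]; apply: sumr_ge0.
apply: countable_bigcupT_measurable => // p.
have [pb|npb] := boolP (self_avoiding_between G x y p); last first.
  by rewrite (_ : F p = set0)//; apply/seteqP; split => om // -[]; rewrite (negPf npb).
rewrite (_ : F p = (fun om => path_time (fun e => w e om) p) @^-1` `]-oo, c[).
  by rewrite -[X in measurable X]setTI; apply: measurable_path_time => //;
    exact: measurable_itv.
by apply/seteqP; split => om /=; rewrite in_itv/=; [case|].
Qed.

Variables (nu : probability (measurableTypeR R) R) (lo hi : R).
Hypotheses (nuE : nu `[lo, hi]%classic = 1%E) (lo0 : 0 < lo).
Hypothesis wnu : forall e A, measurable A -> distribution P (w e) A = nu A.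

Lemma mean_weight e : (\int[P]_om (w e om)%:E = \int[nu]_x x%:E)%E.
Proof.
have De : distribution P (w e) `[lo, hi]%classic = 1%E.
  by rewrite wnu//; exact: measurable_itv.
have [_ <-] := @integral_law _ _ _ P (w e) id (concentrated_mean De).
by apply: eq_measure_integral => A mA _; rewrite [LHS]wnu.
Qed.

Lemma mean_path_time (p : seq (E * V)) :
  (\int[P]_om (path_time (fun e => w e om) p)%:E
    = (path_length p)%:R%:E * \int[nu]_x x%:E)%E.
Proof.
rewrite /path_time; under eq_integral do rewrite -sumEFin.
rewrite ge0_integral_sum//; last 2 first.
- by move=> e; apply/measurable_EFinP; exact: (measurable_funPT (w e)).
- by move=> e om _; rewrite lee_fin.
under eq_bigr do rewrite mean_weight.
have fin : (\int[nu]_x x%:E)%E \is a fin_num.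
  exact: integrable_fin_num (concentrated_mean nuE).
by rewrite -(fineK fin) sumEFin sum_const_fset -EFinM mulr_natl.
Qed.

(** Almost surely all of the countably many weights lie in [[lo, hi]], and then [p] is
    an optimal path. *)
Lemma mean_passage_time_undetoured (eps : R) x p :
  countable [set: E] -> countable [set: seq (E * V)] ->
  hi <= (1 + eps) * lo -> undetoured G eps x p ->
  (mean_passage_time G w x (endpoint x p)
    = (path_length p)%:R%:E * \int[nu]_x x%:E)%E.
Proof.
move=> cE cp hilo und; rewrite -mean_path_time /mean_passage_time unlock.
have pb : self_avoiding_between G x (endpoint x p) p.
  by rewrite /self_avoiding_between eqxx und.1.
have mitv : measurable (`[lo, hi]%classic : set (measurableTypeR R)).
  exact: measurable_itv.
have bad e : P.-negligible (w e @^-1` (~` `[lo, hi]%classic)).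
  exists (w e @^-1` (~` `[lo, hi]%classic)); split => //.
    by rewrite -[X in measurable X]setTI; apply: measurable_funPT => //; exact: measurableC.
  have := wnu e (measurableC mitv); rewrite (concentrated_setC0 nuE).
  by [].
apply: ae_eq_integral => //.
- by apply/measurable_EFinP; exact: measurable_passage_time pb.
- by apply/measurable_EFinP; exact: measurable_path_time.
change (P.-negligible (~` [set om | setT om ->
  (passage_time G (fun e => w e om) x (endpoint x p))%:E
  = (path_time (fun e => w e om) p)%:E])).
apply: negligibleS (countable_negligible cE bad) => om /=.
move=> ne; apply: contrapT => none; apply: ne => _; congr EFin.
apply: (undetoured_passage_time und lo0 hilo) => e.
apply: contrapT => we; apply: none; exists e => //.
Qed.

End PassageTime.

(** * Geodesic percolation in bounded degree *)

Section GeodesicPercolation.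
Variables (R : realType) (V E : choiceType) (G : multigraph V E) (D : nat).
Hypotheses (lf : locally_finite G) (degD : forall v, (degree G v <= D)%N).

Section Escape.
Context d (Omega : measurableType d) (P : probability Omega R).
Variables (X : E -> {RV P >-> bool}) (q : R).
Hypotheses (q01 : 0 <= q <= 1) (Xq : iid X (bernoulli_prob q)).

Definition open_path (p : seq (E * V)) : set Omega :=
  \bigcap_(e in [set` edges p]) X e @^-1` [set true].

Lemma measurable_open_path p : measurable (open_path p).
Proof.
apply: fin_bigcap_measurable => // e _.
by rewrite -[Y in measurable Y]setTI; exact: measurable_funPT.
Qed.

Lemma open_path_prob p : P (open_path p) = (q ^+ path_length p)%:E.
Proof.
have [ind dist] := Xq.
rewrite /open_path ind//; have Xe e : P (X e @^-1` [set true]) = q%:E.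
  by have := dist e [set true] I; rewrite /= /bernoulli_prob q01 fsbig_set1.
under eq_bigr do rewrite Xe.
by rewrite prodEFin big_const_seq count_predT iter_mulr_1.
Qed.

Definition geodesic_walks o r : seq (seq (E * V)) :=
  [seq p <- walks G r.+1 o |
    `[< [/\ self_avoiding G o p, size p = r.+1 & edge_geodesic G o p] >]].

(** A finite description of the event, which yields its measurability and allows a
    union bound. *)
Lemma escapes_geodesic_walks o r :
  [set om | escapes G (edge_geodesic G) (fun e => X e om) o r]
  = \big[setU/set0]_(p <- geodesic_walks o r) open_path p.
Proof.
rewrite -bigcup_seq; apply/seteqP; split => om /=.
  move=> /escaping_geodesic_prefix[p [sp zp gp op]]; exists p => //=.
  rewrite mem_filter; apply/andP; split; first exact/asboolP.
  by apply: mem_walks => //; case: gp.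
move=> [p /=]; rewrite mem_filter => /andP[/asboolP[sp zp gp] _] op.
exists p; split => //; first by case: gp.
by rewrite /graph_ball/= -(edge_geodesic_dist gp) (self_avoiding_length sp) zp ltnn.
Qed.

Lemma escape_prob_le o r :
  (P [set om | escapes G (edge_geodesic G) (fun e => X e om) o r]
    <= ((D%:R * q) ^+ r.+1)%:E)%E.
Proof.
rewrite escapes_geodesic_walks.
have union_bound (s : seq (seq (E * V))) :
    (P (\big[setU/set0]_(p <- s) open_path p) <= \sum_(p <- s) P (open_path p))%E.
  elim: s => [|p s IHs]; first by rewrite !big_nil measure0.
  rewrite !big_cons; apply: le_trans (leeD2l _ IHs).
  apply: measureU2; first exact: measurable_open_path.
  by apply: bigsetU_measurable => p' _; exact: measurable_open_path.
apply: le_trans (union_bound _) _.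
rewrite big_seq (eq_bigr (fun=> (q ^+ r.+1)%:E)); last first.
  move=> p; rewrite mem_filter => /andP[/asboolP[sp zp _] _].
  by rewrite open_path_prob (self_avoiding_length sp) zp.
rewrite -big_seq sumEFin lee_fin big_const_seq count_predT iter_addr_0.
rewrite -[leLHS]mulr_natl exprMn; apply: ler_wpM2r; first by apply: exprn_ge0; case/andP: q01.
rewrite -natrX ler_nat; apply: leq_trans (size_walks r.+1 o degD).
by rewrite size_filter count_size.
Qed.

End Escape.

(** At this density the expected number of open geodesics of length [n] from a given
    vertex is at most [2 ^- n]. *)
Lemma geodesic_exponential_decay :
  exponential_decay G (edge_geodesic G) ((2 * D.+1%:R)^-1 : R).
Proof.
set q := _^-1 => d Omega P X Xq.
have D0 : 0 < D.+1%:R :> R by rewrite ltr0n.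
have q0 : 0 < q by rewrite invr_gt0 mulr_gt0.
have q1 : q <= 1 by rewrite invf_le1 ?mulr_gt0 // -natrM ler1n muln_gt0.
have q01 : 0 <= q <= 1 by rewrite ltW.
have Dq : D%:R * q <= 2^-1.
  rewrite /q invfM mulrCA ger_pMr ?invr_gt0// ler_pdivrMr// mul1r ler_nat.
  exact: leqnSn.
apply: (@le_lt_trans _ _ (- ln 2)%:E); last first.
  by rewrite lte_fin oppr_lt0 ln_gt0// ltr1n.
rewrite /limn_esup limf_esupE; apply: ge_ereal_inf.
eexists; first by exists [set r | (0 < r)%N] => //; exists 1%N.
apply: ge_ereal_sup => _ [r /= r0 <-]; apply: ge_ereal_sup => _ [v _ <-].
have r0' : 0 < r%:R :> R by rewrite ltr0n.
rewrite lee_pdivrMl//.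
have bound : (P [set om | escapes G (edge_geodesic G) (fun e => X e om) v r]
    <= (2^-1 ^+ r)%:E)%E.
  apply: le_trans (escape_prob_le q01 Xq v r) _; rewrite lee_fin.
  apply: (@le_trans _ _ (2^-1 ^+ r.+1)).
    by apply: lerXn2r => //; rewrite nnegrE// mulr_ge0// ltW.
  by rewrite exprS ler_piMl// invf_le1// ler1n.
apply: (@le_trans _ _ (lne (2^-1 ^+ r)%:E)).
  by rewrite lee_lne// in_itv/= ?measure_ge0 ?leey// lee_fin exprn_ge0.
rewrite lne_EFin ?exprn_gt0// -EFinM lee_fin lnXn// lnV ?posrE//.
by rewrite [leRHS]mulr_natl.
Qed.

Lemma pc_geo_low_gt0 : 0 < pc_geo_low R G.
Proof.
have D0 : 0 < D.+1%:R :> R by rewrite ltr0n.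
have q0 : 0 < (2 * D.+1%:R)^-1 :> R by rewrite invr_gt0 mulr_gt0.
apply: lt_le_trans q0 _; apply: sup_upper_bound.
  split; last by exists 1 => p /= [/andP[]].
  exists (2 * D.+1%:R)^-1; split; last exact: geodesic_exponential_decay.
  by rewrite invr_ge0 mulr_ge0//= invf_le1 ?mulr_gt0// -natrM ler1n muln_gt0.
split; last exact: geodesic_exponential_decay.
by rewrite invr_ge0 mulr_ge0//= invf_le1 ?mulr_gt0// -natrM ler1n muln_gt0.
Qed.

End GeodesicPercolation.

(** * Digits of a uniform point *)

Section Digits.
Variables (R : realType) (b : nat).
Local Notation B := b.+2.
Local Notation U := (uniform_prob (@ltr01 R)).

(** For [om] in the unit interval, the first [N] digits in base [B], read as one
    integer. *)
Definition scaled (N : nat) (om : measurableTypeR R) : nat := Num.truncn (B%:R ^+ N * om).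
Definition digit (n : nat) (om : measurableTypeR R) : nat := scaled n.+1 om %% B.

Lemma ltn_digit n om : (digit n om < B)%N.
Proof. exact: ltn_pmod. Qed.

Let BN0 N : 0 < B%:R ^+ N :> R. Proof. by rewrite exprn_gt0. Qed.

Lemma scaled_div N om : 0 <= om -> scaled N om = (scaled N.+1 om %/ B)%N.
Proof.
move=> om0; rewrite /scaled; set y := B%:R ^+ N.+1 * om.
have y0 : 0 <= y by rewrite mulr_ge0// ltW.
have -> : B%:R ^+ N * om = y / B%:R.
  by rewrite /y exprSr [_ * B%:R * om]mulrAC mulfK ?pnatr_eq0.
apply: truncn_def; set k := Num.truncn y.
have /andP[ky yk] : k%:R <= y < k.+1%:R := truncn_itv y0.
rewrite ler_pdivlMr// ltr_pdivrMr// -!natrM; apply/andP; split.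
  by apply: le_trans ky; rewrite ler_nat leq_trunc_div.
by apply: lt_le_trans yk _; rewrite ler_nat ltn_ceil.
Qed.

Lemma measurable_scaled_eq N k : measurable [set om | scaled N om = k].
Proof.
have m n : measurable [set om | (scaled N om <= n)%N].
  rewrite (_ : [set om | _] = affine 0 (B%:R ^+ N) @^-1` `]-oo, n.+1%:R[).
    by apply: measurable_preimage_affine; exact: measurable_itv.
  by apply/seteqP; split => om /=; rewrite truncn_le_nat in_itv/= /affine add0r.
case: k => [|k].
  rewrite (_ : [set om | _] = [set om | (scaled N om <= 0)%N])//.
  by apply/seteqP; split => om /=; [move->|rewrite leqn0 => /eqP].
rewrite (_ : [set om | _] =
  [set om | (scaled N om <= k.+1)%N] `\` [set om | (scaled N om <= k)%N]).
  exact: measurableD.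
apply/seteqP; split => om /=; first by move=> ->; rewrite ltnn leqnn.
by move=> [le1 /negP]; rewrite -ltnNge => lt1; apply/eqP; rewrite eqn_leq le1.
Qed.

Lemma measurable_digit_comp n (g : nat -> measurableTypeR R) :
  measurable_fun [set: measurableTypeR R] (g \o digit n).
Proof.
move=> _ A mA; rewrite setTI.
rewrite (_ : _ @^-1` _ = \bigcup_(k in [set k | A (g (k %% B)%N)])
    [set om | scaled n.+1 om = k]).
  by apply: bigcup_measurable => k _; exact: measurable_scaled_eq.
apply/seteqP; split => om /=; first by move=> Aom; exists (scaled n.+1 om).
by move=> [k /= Ak omk]; rewrite /digit omk.
Qed.

Let cell N k : set (measurableTypeR R) :=
  `[k%:R / B%:R ^+ N, k.+1%:R / B%:R ^+ N[%classic.

Let mem_cell N k om : cell N k om <-> 0 <= om /\ scaled N om = k.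
Proof.
rewrite /cell /= in_itv/= ler_pdivrMr// ltr_pdivlMr// mulrC; split.
  move=> kom; have /andP[k0 _] := kom; split; last exact: truncn_def.
  by rewrite -(pmulr_rge0 _ (BN0 N)); apply: le_trans k0.
by move=> [om0 <-]; apply: truncn_itv; rewrite mulr_ge0// ltW.
Qed.

(** The event is a disjoint union of cells of length [B ^- N], one for each admissible
    integer. *)
Lemma scaled_prob N (Q : pred nat) :
  U ([set om | 0 <= om < 1] `&` [set om | Q (scaled N om)])
  = ((\sum_(0 <= k < B ^ N) Q k)%N%:R / B%:R ^+ N)%:E.
Proof.
have -> : [set om | 0 <= om < 1] `&` [set om | Q (scaled N om)] =
    \big[setU/set0]_(k < B ^ N | Q k) cell N k.
  rewrite -(big_mkord Q (cell N)) -bigcup_seq_cond; apply/seteqP; split => om /=.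
    move=> [/andP[om0 om1] Qom]; exists (scaled N om) => /=; last exact/mem_cell.
    rewrite mem_index_iota Qom andbT /= -(ltr_nat R) natrX.
    have /andP[le_om _] := truncn_itv (mulr_ge0 (ltW (BN0 N)) om0).
    by apply: le_lt_trans le_om _; rewrite -[ltRHS]mulr1 ltr_pM2l.
  move=> [k /=]; rewrite mem_index_iota /= => /andP[kB Qk] ck.
  move: (ck) => /mem_cell[om0 omk].
  rewrite omk; split => //; rewrite om0/=.
  move: ck; rewrite /cell /= in_itv/= => /andP[_ omlt].
  by apply: lt_le_trans omlt _; rewrite ler_pdivrMr// mul1r -natrX ler_nat.
rewrite (measure_bigsetU_ord_cond U); last 2 first.
- by move=> k _; exact: measurable_itv.
- move=> i j _ _ [om [/mem_cell[_ si] /mem_cell[_ sj]]].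
  by apply: val_inj; exact: etrans (esym si) sj.
rewrite (eq_bigr (fun=> (B%:R ^- N)%:E)); last first.
  move=> k _; rewrite [LHS](uniform_prob_itv ltr01).
  - by rewrite subr0 divr1 -mulrBl -natrB// subSnn mul1r.
  - by rewrite divr_ge0// ltW.
  - by rewrite ler_pM2r ?invr_gt0// ler_nat.
  - by rewrite ler_pdivrMr// mul1r -natrX ler_nat.
rewrite sumEFin big_mkord natr_sum mulr_suml [in LHS]big_mkcond /=.
by congr EFin; apply: eq_bigr => k _; case: (Q k); rewrite ?mul1r ?mul0r.
Qed.

(** An integer below [m * B] amounts to its quotient by [B] and its last digit. *)
Lemma count_prefix m (Q S : pred nat) :
  (\sum_(0 <= k < m * B) (Q (k %/ B) && S (k %% B))
   = (\sum_(0 <= k < m) Q k) * \sum_(0 <= t < B) S t)%N.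
Proof.
rewrite big_nat_mul big_distrl /=; apply: eq_bigr => i _.
rewrite -{1}[(i * B)%N]add0n big_addn mulSn addnK big_distrr /=.
rewrite !big_mkord; apply: eq_bigr => -[t tB] _ /=.
by rewrite [(t + _)%N]addnC divnMDl// modnMDl divn_small// addn0 modn_small// mulnb.
Qed.

(** The digits are independent and uniformly distributed: a condition on each of the
    first [N] digits is a condition on the integer [scaled N], and appending a digit
    multiplies the number of admissible integers. *)
Lemma digits_prob N (S : nat -> pred nat) :
  U ([set om | 0 <= om < 1] `&`
     [set om | forall i, (i < N)%N -> S i (digit i om)])
  = (\prod_(0 <= i < N) ((\sum_(0 <= t < B) S i t)%N%:R / B%:R))%:E.
Proof.
pose fix Q n : pred nat := fun k =>
  if n is n'.+1 then Q n' (k %/ B)%N && S n' (k %% B)%N else true.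
have QP n om : 0 <= om ->
    Q n (scaled n om) <-> forall i, (i < n)%N -> S i (digit i om).
  move=> om0; elim: n => [|n IHn] //=; rewrite -scaled_div//; split.
    move=> /andP[/IHn Sn Snn] i; rewrite ltnS leq_eqVlt => /predU1P[->//|].
    exact: Sn.
  move=> Si; apply/andP; split; last exact: Si.
  by apply/IHn => i iN; apply: Si; rewrite ltnS ltnW.
have -> : [set om | 0 <= om < 1] `&`
      [set om | forall i, (i < N)%N -> S i (digit i om)]
    = [set om | 0 <= om < 1] `&` [set om | Q N (scaled N om)].
  by apply/seteqP; split => om /= [om01 h]; split => //; apply/(QP N om) => //;
    case/andP: om01.
rewrite scaled_prob; congr EFin.
elim: N => [|N IHN]; first by rewrite big_nat1 big_nil mul1r invr1.
rewrite expnSr count_prefix exprSr natrM invfM mulrACA IHN.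
by rewrite [RHS]big_nat_recr.
Qed.

End Digits.

(** * Independent families read off the digits *)

Section DigitFamily.
Variables (R : realType) (b : nat) (g : nat -> measurableTypeR R).
Local Notation B := b.+2.
Local Notation U := (uniform_prob (@ltr01 R)).

Definition digit_var (n : nat) : measurableTypeR R -> measurableTypeR R :=
  g \o digit b n.

HB.instance Definition _ n :=
  isMeasurableFun.Build _ _ _ _ (digit_var n) (measurable_digit_comp b n g).

Definition digit_freq (A : set R) : R :=
  (\sum_(0 <= t < B) `[< A (g t) >])%N%:R / B%:R.

(** Digits are analysed on the unit interval only, which has full mass. *)
Lemma uniform01_setI (A : set (measurableTypeR R)) : measurable A ->
  U A = U ([set om | 0 <= om < 1] `&` A).
Proof.
move=> mA; pose I : set (measurableTypeR R) := `[0, 1[%classic.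
have -> : [set om : R | 0 <= om < 1] = I.
  by apply/seteqP; split => om; rewrite /I /= in_itv.
have mI : measurable I by exact: measurable_itv.
have I1 : U I = 1%E by rewrite uniform_prob_itv// subr0 divff.
have IC : U (~` I) = 0%E by rewrite probability_setC// [X in (_ - X)%E]I1 subee.
have mC := measurableC mI.
apply/eqP; rewrite eq_le; apply/andP; split; last first.
  by apply: le_measure => //; apply/mem_set => //; exact: measurableI.
apply: (@le_trans _ _ (U (I `&` A) + U (~` I))%E).
  apply: le_trans (measureU2 _ (measurableI _ _ mI mA) mC).
  apply: le_measure.
  - exact/mem_set.
  - by apply/mem_set/measurableU => //; exact: measurableI.
  - by move=> om Aom; have [?|?] := pselect (I om); [left|right].
by rewrite [X in (_ + X)%E]IC adde0.
Qed.

Lemma measurable_digit_var n (A : set (measurableTypeR R)) :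
  measurable A -> measurable (digit_var n @^-1` A).
Proof.
by move=> mA; rewrite -[X in measurable X]setTI; exact: measurable_digit_comp.
Qed.

(** The digits whose index comes from no member of [J] carry the empty condition,
    which contributes a factor 1. *)
Lemma digit_family_prob (I : choiceType) (idx : I -> nat) (J : {fset I})
    (A : I -> set (measurableTypeR R)) :
  injective idx -> (forall i, measurable (A i)) ->
  U (\bigcap_(i in [set` J]) digit_var (idx i) @^-1` A i)
  = (\prod_(i <- J) digit_freq (A i))%:E.
Proof.
move=> inj mA; rewrite uniform01_setI; last first.
  by apply: fin_bigcap_measurable => // i _; exact: measurable_digit_var.
pose N := (\max_(i <- J) (idx i).+1)%N.
have idxN i : i \in J -> (idx i < N)%N by move=> iJ; apply: (leq_bigmax_seq i).
pose S n t := `[< forall i, i \in J -> idx i = n -> A i (g t) >].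
have SJ i t : i \in J -> S (idx i) t = `[< A i (g t) >].
  move=> iJ; apply/asboolP/asboolP; first exact.
  by move=> Ai j _ /inj ->.
have -> : \bigcap_(i in [set` J]) digit_var (idx i) @^-1` A i
    = [set om | forall n, (n < N)%N -> S n (digit b n om)].
  apply/seteqP; split => om /=.
    by move=> h n _; apply/asboolP => i iJ <-; exact: h.
  by move=> h i /= iJ; have := h _ (idxN i iJ); rewrite SJ// => /asboolP.
rewrite digits_prob; congr EFin.
rewrite (bigID (mem (map idx J))) /= [X in _ * X]big1 ?mulr1; last first.
  move=> n nJ; rewrite (eq_bigr (fun=> 1%N)).
    by rewrite sum_nat_const_nat subn0 muln1 divff// pnatr_eq0.
  move=> t _; rewrite (_ : S n t = true)//; apply/asboolP => i iJ idxi.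
  by move: nJ; rewrite -idxi map_f.
rewrite -big_filter (perm_big (map idx J)) /=; last first.
  apply: uniq_perm; first exact/filter_uniq/iota_uniq.
    by rewrite map_inj_uniq.
  move=> n; rewrite mem_filter mem_index_iota /=.
  by apply/andP/idP => [[]//|nJ]; split => //; case/mapP: nJ => i iJ ->; exact: idxN.
rewrite big_map big_seq [RHS]big_seq; apply: eq_bigr => i iJ.
by rewrite /digit_freq; congr (_%:R / _); apply: eq_bigr => t _; rewrite SJ.
Qed.

Lemma digit_var_prob n (A : set (measurableTypeR R)) : measurable A ->
  U (digit_var n @^-1` A) = (digit_freq A)%:E.
Proof.
move=> mA; have := @digit_family_prob nat id [fset n]%fset (fun=> A) (fun _ _ => id) (fun=> mA).
rewrite big_seq_fset1 => <-; congr (U _).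
apply/seteqP; split => om /=; first by move=> An i /= /fset1P ->.
by apply; rewrite /= inE.
Qed.

End DigitFamily.

(** * A centred law with small atoms *)

Section GridLaw.
Variables (R : realType) (b : nat).
Local Notation B := b.+2.
Local Notation U := (uniform_prob (@ltr01 R)).

Definition grid_point (t : nat) : R := 2 * t%:R / b.+1%:R - 1.

(** Uniform on [B] equally spaced points of [[-1, 1]], realized by the first digit of
    a uniform point. *)
Definition grid_law : probability (measurableTypeR R) R :=
  distribution U (digit_var b grid_point 0).

Let b0 : 0 < b.+1%:R :> R. Proof. by rewrite ltr0n. Qed.

Lemma grid_point_itv t : (t < B)%N -> -1 <= grid_point t <= 1.
Proof.
rewrite ltnS -(ler_nat R) => tb; rewrite /grid_point.
have h0 : 0 <= 2 * t%:R / b.+1%:R :> R by rewrite divr_ge0 ?mulr_ge0// ltW.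
have h2 : 2 * t%:R / b.+1%:R <= 2 :> R by rewrite ler_pdivrMr// ler_pM2l.
by rewrite lerBlDr lerBrDr addNr h0.
Qed.

Lemma grid_point_inj : injective grid_point.
Proof.
move=> s t /addIr /(congr1 ( *%R^~ b.+1%:R)); rewrite !divfK ?gt_eqF//.
by move=> /(mulfI _) h; apply/eqP; rewrite -(eqr_nat R); apply/eqP/h.
Qed.

Lemma grid_law_concentrated : grid_law `[-1, 1]%classic = 1%E.
Proof.
rewrite -(probability_setT U); congr (U _); apply/seteqP; split => // om _ /=.
by rewrite in_itv/=; apply/grid_point_itv/ltn_digit.
Qed.

Lemma sum_grid_point : \sum_(0 <= t < B) grid_point t = 0.
Proof.
have sum_double n : \sum_(0 <= t < n.+1) 2 * t%:R = n.+1%:R * n%:R :> R.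
  elim: n => [|n IHn]; first by rewrite big_nat1 !mulr0.
  by rewrite big_nat_recr//= IHn -[n.+2]addn2 -[n.+1]addn1 !natrD; ring.
rewrite sumrB -mulr_suml sum_double mulfK ?gt_eqF//.
by rewrite sumr_const_nat subn0 subrr.
Qed.

Let natm (t : nat) : measurableTypeR R := (t%:R : R).

Let digit_eqE t : [set om | digit b 0 om = t] = digit_var b natm 0 @^-1` [set natm t].
Proof.
apply/seteqP; split => om; rewrite /digit_var /natm /=; first by move->.
by move=> /eqP; rewrite eqr_nat => /eqP.
Qed.

Lemma digit_eq_prob t : (t < B)%N ->
  U [set om | digit b 0 om = t] = (B%:R^-1)%:E.
Proof.
move=> tB; rewrite digit_eqE.
rewrite digit_var_prob; last exact: measurable_set1.
rewrite /digit_freq (bigD1_seq t) ?mem_index_iota ?iota_uniq//= big1.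
  by rewrite asboolT// addn0 mul1r.
by move=> s st; rewrite asboolF//= /natm => /eqP; rewrite eqr_nat (negPf st).
Qed.

(** The integrand is a combination of the indicators of the [B] digit events, each of
    probability [B^-1]. *)
Lemma grid_law_mean : (\int[grid_law]_x x%:E = 0)%E.
Proof.
have [_ ->] := @integral_law _ _ _ U (digit_var b grid_point 0) id
  (concentrated_mean grid_law_concentrated).
have mD t : measurable [set om : measurableTypeR R | digit b 0 om = t].
  by rewrite digit_eqE; apply: measurable_digit_var; exact: measurable_set1.
transitivity (\int[U]_om (\sum_(0 <= t < B)
    (grid_point t)%:E * (\1_[set om' | digit b 0 om' = t] om)%:E))%E.
  apply: eq_integral => om _.
  rewrite (bigD1_seq (digit b 0 om)) ?mem_index_iota ?ltn_digit ?iota_uniq//=.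
  rewrite big1 ?adde0; last first.
    move=> t tom; rewrite indicE memNset ?mule0//= => omt.
    by move: tom; rewrite omt eqxx.
  by rewrite indicE mem_set// mule1.
have iI t : U.-integrable [set: R] (fun om => (\1_[set om' | digit b 0 om' = t] om)%:E).
  exact: integrable_indic.
rewrite integral_sum//; last by move=> t; exact: integrableZl.
rewrite big_seq (eq_bigr (fun t => (grid_point t / B%:R)%:E)); last first.
  move=> t; rewrite mem_index_iota /= => tB.
  rewrite integralZl// integral_indic// setIT.
  by rewrite [X in (_ * X)%E](digit_eq_prob tB).
by rewrite -big_seq sumEFin -mulr_suml sum_grid_point mul0r.
Qed.

Lemma grid_law_atom (x : R) : (grid_law [set x] <= (B%:R^-1)%:E)%E.
Proof.
pose A := digit_var b grid_point 0 @^-1` [set x]; change (U A <= (B%:R^-1)%:E)%E.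
have [[om /= omx]|none] := pselect (A !=set0); last first.
  have -> : A = set0 by apply/seteqP; split => // om Aom; apply: none; exists om.
  by rewrite measure0 lee_fin invr_ge0.
rewrite -(digit_eq_prob (ltn_digit b 0 om)); apply: le_measure.
- by apply/mem_set; apply: measurable_digit_var; exact: measurable_set1.
- by apply/mem_set; rewrite digit_eqE; apply: measurable_digit_var; exact: measurable_set1.
- by move=> om' /= om'x; apply: grid_point_inj; exact: etrans om'x (esym omx).
Qed.

Lemma grid_law_top (A : set (measurableTypeR R)) : measurable A -> A 1 ->
  (0 < grid_law A)%E.
Proof.
move=> mA A1; apply: (@lt_le_trans _ _ (B%:R^-1)%:E).
  by rewrite lte_fin invr_gt0.
rewrite -(digit_eq_prob (ltnSn b.+1)); apply: le_measure.
- by apply/mem_set; rewrite digit_eqE; apply: measurable_digit_var; exact: measurable_set1.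
- by apply/mem_set; apply: measurable_digit_var.
- move=> om /= omb; rewrite /digit_var /= omb /grid_point mulfK ?gt_eqF//.
  by rewrite (_ : 2 - 1 = 1 :> R)//; lra.
Qed.

(** The support is thus nonempty, and its infimum meaningful. *)
Lemma grid_spread_support c r : law_support (spread grid_law c r) (c + r).
Proof.
move=> O oO Ocr; rewrite spreadE; apply: grid_law_top; last by rewrite /= /affine mulr1.
by apply: measurable_preimage_affine; exact: open_measurable.
Qed.

(** A large [B] makes all atoms smaller than a given threshold. *)
Lemma grid_spread_atom c r x : r != 0 ->
  (spread grid_law c r [set x] <= (B%:R^-1)%:E)%E.
Proof.
move=> r0; rewrite spreadE.
rewrite (_ : _ @^-1` _ = [set affine (- (c / r)) r^-1 x]); first exact: grid_law_atom.
apply/seteqP; split => y /=; first by move=> <-; rewrite affine_inv.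
by move=> ->; rewrite /affine; field.
Qed.

(** Independent weights with the laws above, on the unit interval with Lebesgue
    measure: each edge reads a digit of its own. *)
Lemma grid_weights_exist (E : choiceType) (c r : R) :
  countable [set: E] -> 0 <= r -> r <= c ->
  exists w : E -> {RV U >-> measurableTypeR R}, iid_weights (spread grid_law c r) w.
Proof.
move=> /countable_injP[idx /in2TT inj] r0 rc.
pose g := affine c r \o grid_point.
exists (fun e => digit_var b g (idx e) : {mfun _ >-> _}).
split; last first.
  move=> e om; rewrite /= /digit_var /g /= /affine.
  by have /andP[z1 _] := grid_point_itv (ltn_digit b (idx e) om); nra.
split=> [J A mA|e A mA].
  rewrite [LHS](digit_family_prob b g J inj mA) -prodEFin.
  by apply: eq_bigr => e _; rewrite [RHS]digit_var_prob.
rewrite [LHS](digit_var_prob b g (idx e) mA) spreadE.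
by rewrite -[RHS]/(U (digit_var b g 0 @^-1` A)) [RHS]digit_var_prob.
Qed.

End GridLaw.

(** * Laws of equal mean passage times *)

Section SpreadPair.
Variables (R : realType) (mu : probability (measurableTypeR R) R).
Hypotheses (mu1 : mu `[-1, 1]%classic = 1%E) (mean0 : (\int[mu]_x x%:E = 0)%E).
Variables (eps : R) (V E : choiceType) (G : multigraph V E).
Hypothesis hG : ambient_graph G.

(** The law lives on [[1, 1 + eps]], so that [p] is almost surely optimal; the value is
    independent of the width [r]. *)
Lemma spread_mean_passage_time (r : R) x p n d (Omega : measurableType d)
    (P : probability Omega R) (w : E -> {RV P >-> measurableTypeR R}) :
  0 <= r -> r <= eps / 2 ->
  undetoured G eps x p -> path_length p = n ->
  iid_weights (spread mu (1 + eps / 2) r) w ->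
  mean_passage_time G w x (endpoint x p) = (n%:R * (1 + eps / 2))%:E.
Proof.
move=> r0 rle und <- [[_ wnu] w0]; have [_ lf cV _] := hG.
have lo0 : 0 < 1 + eps / 2 - r by lra.
have hilo : 1 + eps / 2 + r <= (1 + eps) * (1 + eps / 2 - r) by nra.
rewrite (mean_passage_time_undetoured w0 (spread_concentrated mu1 _ r0) lo0 wnu
  (countable_edges lf cV) (countable_paths lf cV) hilo und).
by rewrite spread_mean.
Qed.

End SpreadPair.

Theorem theorem4p1 (R : realType) (V E : choiceType) (G : multigraph V E)
    (hG : ambient_graph G) (hdet : ~ admits_detours G R) :
  (exists (x y : nat -> V) (nu nut : probability (measurableTypeR R) R),
    [/\ (dist G (x n) (y n) @[n --> \oo] --> \oo),
        [/\ on_nonneg nu, atomless nu, finite_mean nu & supported_away_from0 nu],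
        [/\ on_nonneg nut, atomless nut, finite_mean nut
          & supported_away_from0 nut],
        strictly_more_variable nut nu
      & forall (d d' : measure_display) (Omega : measurableType d)
          (Omega' : measurableType d') (P : probability Omega R)
          (P' : probability Omega' R)
          (w : E -> {RV P >-> measurableTypeR R})
          (wt : E -> {RV P' >-> measurableTypeR R}),
        iid_weights nu w -> iid_weights nut wt ->
        forall n, mean_passage_time G w (x n) (y n)
                  = mean_passage_time G wt (x n) (y n)]) /\
  (bounded_degree G -> ~ vdBK_property R G).
Proof.
have [eps eps0 undet] := undetoured_exists hdet.
have /choice[z zP] n : exists z : V * seq (E * V),
    undetoured G eps z.1 z.2 /\ path_length z.2 = n.+1.
  by have [x [p xp]] := undet n; exists (x, p).
pose x n := (z n).1; pose y n := endpoint (z n).1 (z n).2.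
have dist_xy n : dist G (x n) (y n) = n.+1.
  by have [und <-] := zP n; exact: undetoured_dist eps0 und.
(* chosen for c - r = 1 and c + r = 1 + eps *)
pose c := 1 + eps / 2; pose r := eps / 2; pose s := eps / 4.
have [r0 s0 sr] : [/\ 0 < r, 0 < s & s < r] by rewrite /r /s; split; lra.
have sr2 : s / r = 2^-1 by rewrite /s /r; field; rewrite gt_eqF.
split.
  pose mu := uniform_prob (ltN11 R).
  have mu1 : mu `[-1, 1]%classic = 1%E := uniform_prob_itvT _.
  have mean0 : (\int[mu]_x x%:E = 0)%E := uniform_mean R.
  have law t : 0 < t -> t <= r -> [/\ on_nonneg (spread mu c t),
      atomless (spread mu c t), finite_mean (spread mu c t)
      & supported_away_from0 (spread mu c t)].
    move=> t0 tr; have conc := spread_concentrated mu1 c (ltW t0).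
    have lo0 : 0 < c - t by move: tr; rewrite /c /r; lra.
    split; [exact: concentrated_nonneg conc (ltW lo0)|
      |exact: concentrated_mean conc|exact: concentrated_away0 conc lo0].
    by apply: atomless_spread; [rewrite gt_eqF|exact: atomless_uniform].
  exists x, y, (spread mu c s), (spread mu c r); split.
  - apply/cvgnyPge => k; exists k => // n /= kn; rewrite dist_xy.
    exact: leqW.
  - exact: law s0 (ltW sr).
  - exact: law r0 (lexx r).
  - apply: spread_strictly_more_variable => //; rewrite sr2.
    apply: (@lt_le_trans _ _ (mu `]2^-1, 1]%classic)).
      rewrite [ltRHS](uniform_prob_itv (ltN11 R)) ?lte_fin ?divr_gt0//; lra.
    apply: le_measure; [apply/mem_set|apply/mem_set|].
    - exact: measurable_itv.
    - exact: measurable_itv.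
    - by move=> t /=; rewrite !in_itv/= => /andP[-> _].
  - move=> d d' Omega Omega' P P' w wt iw iwt n; have [und len] := zP n.
    rewrite (spread_mean_passage_time mu1 mean0 hG (ltW s0) (ltW sr) und len iw).
    by rewrite (spread_mean_passage_time mu1 mean0 hG (ltW r0) (lexx r) und len iwt).
move=> [lf [D degD]] vdBK.
have pc0 := pc_geo_low_gt0 R lf degD.
(* so that b.+2, the number of atoms, exceeds the inverse of the threshold *)
pose b := Num.truncn (pc_geo_low R G)^-1.
have bpc : b.+2%:R^-1 < pc_geo_low R G.
  rewrite invf_plt ?posrE//; apply: lt_trans (Num.Theory.truncnS_gt _) _.
  by rewrite ltr_nat.
pose mu := grid_law R b.
have mu1 : mu `[-1, 1]%classic = 1%E := grid_law_concentrated R b.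
have mean0 : (\int[mu]_x x%:E = 0)%E := grid_law_mean R b.
have conc t (t0 : 0 < t) := spread_concentrated mu1 c (ltW t0).
have rc : r <= c by rewrite /r /c; lra.
have [cE cs0] : countable [set: E] /\ 0 < c - s.
  split; last by rewrite /c /s; lra.
  by case: hG => _ lf' cV _; exact: countable_edges lf' cV.
have [w iw] := grid_weights_exist b cE (ltW s0) (le_trans (ltW sr) rc).
have [wt iwt] := grid_weights_exist b cE (ltW r0) rc.
have subcrit : exp_subcritical G (spread mu c s).
  right; split.
    apply: lt_le_trans cs0 (lb_le_inf _ _); first by exists (c + s); exact: grid_spread_support.
    by move=> t /(concentrated_support (conc s s0)) /=; rewrite in_itv/= => /andP[].
  apply: le_lt_trans (grid_spread_atom b c _ _) _; first by rewrite gt_eqF.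
  by rewrite lte_fin.
have more : strictly_more_variable (spread mu c r) (spread mu c s).
  apply: spread_strictly_more_variable => //; rewrite sr2.
  apply: grid_law_top; first exact: measurable_itv.
  by rewrite /= in_itv/= andbT; lra.
have nonneg t (t0 : 0 < t) (tr : t <= r) : on_nonneg (spread mu c t).
  by apply: concentrated_nonneg (conc t t0) _; move: tr; rewrite /c /r; lra.
have := vdBK _ _ (nonneg s s0 (ltW sr)) (nonneg r r0 (lexx r))
  (concentrated_mean (conc s s0)) (concentrated_mean (conc r r0)) subcrit more
  _ _ _ _ _ _ w wt iw iwt.
(* each infimum defining the liminf includes a pair (x n, y n), where the difference
   of the means vanishes *)
apply/negP; rewrite -leNgt; apply: ge_ereal_sup => _ [n _ <-].
apply: ge_ereal_inf; eexists; first by exists (x n, y n) => //=; rewrite dist_xy.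
have [und len] := zP n.
rewrite /= (spread_mean_passage_time mu1 mean0 hG (ltW s0) (ltW sr) und len iw).
rewrite (spread_mean_passage_time mu1 mean0 hG (ltW r0) (lexx r) und len iwt).
by rewrite subee// mul0e.
Qed.
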